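(* For each bounded operator $T$ on $C_0[0,\omega_1)$, there exist a unique scalar $\varphi(T)$ and a closed and unbounded subset $D$ of $[0,\omega_1)$ such that $$(Tf)(\alpha)=\varphi(T)f(\alpha)\qquad (f\in C_0[0,\omega_1),\ \alpha\in D).$$ Moreover, the mapping $T\mapsto\varphi(T)$ is linear and multiplicative, and thus a character on the Banach algebra $\mathscr{B}(C_0[0,\omega_1))$.
   Context: Scalars are in $\mathbb{K}=\mathbb{R}$ or $\mathbb{K}=\mathbb{C}$. $\omega_1$ is the first uncountable ordinal; $[0,\omega_1)$ carries the order topology. $C_0[0,\omega_1)$ is the Banach space (supremum norm) of continuous functions $f\colon[0,\omega_1)\to\mathbb{K}$ that vanish eventually. $\mathscr{B}(X)$ is the Banach algebra of bounded linear operators on $X$. A character is a non-zero scalar-valued algebra homomorphism. *)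

(* Defs.v *)
From HB Require Import structures.
From mathcomp Require Import all_boot all_order all_algebra.
From mathcomp Require Import complex.
From mathcomp Require Import all_classical all_reals wochoice.
From mathcomp Require Import topology normedtype.

Set Implicit Arguments.
Unset Strict Implicit.
Unset Printing Implicit Defensive.

Import Order.TTheory GRing.Theory Num.Theory.
Import numFieldNormedType.Exports.

Local Open Scope classical_set_scope.
Local Open Scope ring_scope.

(* The topology and the norm of a scalar field K are those MathComp-Analysis puts
   on every numFieldType; norms take their values in K, also for K = R[i]. *)
Variant real_or_complex : numFieldType -> Prop :=
| RealScalars (R : realType) : real_or_complex R
| ComplexScalars (R : realType) : real_or_complex R[i].

(* A well-ordered set is order-isomorphic to [0, omega_1) exactly when it is
   uncountable and all its proper initial segments are countable. *)
HB.mixin Record isOmega1 d W & Order.Total d W := {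
  omega1_well_ordered : forall A : set W, A !=set0 -> exists2 m, A m & lbound A m;
  omega1_uncountable : ~ countable [set: W];
  omega1_countable_initial : forall a : W, countable [set x | (x < a)%O]
}.

#[short(type="omega1Type")]
HB.structure Definition Omega1 d := { W of OrderTopological d W & isOmega1 d W }.

Definition club d (W : orderTopologicalType d) (D : set W) :=
  closed D /\ ~ has_ubound D.

Section Omega1Theory.
Context d (W : omega1Type d).
Implicit Types x y z : W.

Lemma omega1_ind (P : W -> Prop) :
  (forall x, (forall y, (y < x)%O -> P y) -> P x) -> forall x, P x.
Proof.
move=> IH x; apply: contrapT => nPx.
have [|m nPm mmin] := @omega1_well_ordered d W [set y | ~ P y]; first by exists x.
apply: nPm; apply: IH => y ym; apply: contrapT => nPy.
by have := mmin _ nPy; rewrite leNgt ym.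
Qed.

Lemma omega1_min : exists m : W, forall x, (m <= x)%O.
Proof.
have [|m _ mP] := @omega1_well_ordered d W setT; last by exists m => x; exact: mP.
apply/set0P/eqP => W0; apply: (@omega1_uncountable d W); rewrite W0.
exact: countable0.
Qed.

Lemma omega1_gt x : exists y, (x < y)%O.
Proof.
apply: contrapT => nx; apply: (@omega1_uncountable d W).
have -> : [set: W] = [set y | (y < x)%O] `|` [set x].
  apply/seteqP; split => // y _ /=.
  have : (y <= x)%O by rewrite leNgt; apply/negP => xy; apply: nx; exists y.
  by rewrite le_eqVlt => /orP[/eqP->|]; [right|left].
rewrite -bigcup2E; apply: bigcup_countable; first exact: countableP.
move=> [|[|n]] _ /=; [exact: omega1_countable_initial| |exact: countable0].
exact: finite_set_countable.
Qed.

Lemma omega1_nbhs_left x z (A : set W) : (z < x)%O -> nbhs x A ->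
  exists2 y, (y < x)%O & forall t, (y < t)%O -> (t <= x)%O -> A t.
Proof.
move=> zx; rewrite itv_nbhsE => -[i [io xi] iA].
case: i io xi iA => [[[]l|[]] [[]r|[]]] //= io; rewrite itv_boundlr => /andP[/= lx xr] iA.
- exists l => // t lt tx; apply: iA => /=; rewrite itv_boundlr /=.
  by apply/andP; split => //; apply: le_lt_trans xr.
- by exists l => // t lt tx; apply: iA; rewrite /= itv_boundlr /= andbT.
- exists z => // t _ tx; apply: iA => /=; rewrite itv_boundlr /=.
  exact: le_lt_trans xr.
- by exists z => // t _ tx; apply: iA; rewrite /= itv_boundlr /=.
Qed.

End Omega1Theory.

Section C0.
Context (K : numFieldType) d (W : omega1Type d).

Definition continuous_vanishing_eventually : {pred W -> K} :=
  fun f => `[< continuous f /\ exists a, forall x, (a <= x)%O -> f x = 0 >].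

Lemma continuous_vanishing_eventually_submod :
  submod_closed continuous_vanishing_eventually.
Proof.
split=> [|c f g /asboolP[fc [a fa]] /asboolP[gc [b gb]]]; apply/asboolP.
  by split; [move=> x; exact: cvg_cst|have [m _] := omega1_min W; exists m].
split=> [x|].
  apply: (@continuousD K K W (c \*: f) g x); last exact: gc.
  by apply: (@continuousZl_tmp K K W f c x); exact: fc.
exists (Order.max a b) => x; rewrite ge_max => /andP[ax bx].
by rewrite !fctE fa// gb// scaler0 addr0.
Qed.

HB.instance Definition _ := GRing.isSubmodClosed.Build K (W -> K)
  continuous_vanishing_eventually continuous_vanishing_eventually_submod.

Record C0 := MkC0 {
  C0_fun :> W -> K;
  _ : C0_fun \in continuous_vanishing_eventually
}.

HB.instance Definition _ := [isSub for C0_fun].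
HB.instance Definition _ := [Choice of C0 by <:].
HB.instance Definition _ := [SubChoice_isSubLmodule of C0 by <:].

Implicit Types f g : C0.

Lemma C0_continuous f : continuous f.
Proof. by have /asboolP[] := valP f. Qed.

Lemma C0_vanishing f : exists a, forall x, (a <= x)%O -> f x = 0.
Proof. by have /asboolP[] := valP f. Qed.

Lemma C0P f g : (forall x, f x = g x) -> f = g.
Proof. by move=> fg; apply/val_inj/funext. Qed.

Lemma C0_maximum f : exists y, forall x, `|f x| <= `|f y|.
Proof.
have real_le (u v : K) : `|u| <= `|v| \/ `|v| < `|u|.
  by have [|] := real_leP (normr_real u) (normr_real v); [left|right].
have below x : exists y, forall t, (t <= x)%O -> `|f t| <= `|f y|.
  elim/omega1_ind: x => x IH.
  have [|/existsNP[z]] := pselect (forall t, (t <= x)%O -> `|f t| <= `|f x|).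
    by exists x.
  move=> /not_implyP[zx /negP fz].
  have fxz : `|f x| < `|f z| by case: (real_le (f z) (f x)) => // h; rewrite h in fz.
  have {}zx : (z < x)%O.
    by rewrite lt_neqAle zx andbT; apply: contraTneq fxz => ->; rewrite ltxx.
  have near_x : nbhs x [set t | `|f t| < `|f z|].
    have e0 : 0 < `|f z| - `|f x| by rewrite subr_gt0.
    have /cvgrPdist_lt /(_ _ e0) := @C0_continuous f x.
    apply: filterS => t /= ft; rewrite -(subrK (f x) (f t)).
    by rewrite (le_lt_trans (ler_normD _ _))// -ltrBrDr distrC.
  have [w wx wP] := omega1_nbhs_left zx near_x.
  have [|y yP] := IH (Order.max w z); first by rewrite gt_max wx zx.
  exists y => t tx; have [tw|wt] := leP t w.
    by apply: yP; rewrite le_max tw.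
  apply: le_trans (yP z _); last by rewrite le_max lexx orbT.
  exact/ltW/wP.
have [a fa] := C0_vanishing f; have [y yP] := below a; exists y => x.
have [xa|/ltW ax] := leP x a; first exact: yP.
by rewrite fa// normr0.
Qed.

(* [supremum] is meaningful although K = R[i] is only partially ordered: by
   C0_maximum the supremum is attained. *)
Definition C0_norm f : K := supremum 0 (range (fun x => `|f x|)).

Lemma C0_norm_max f : exists2 y, C0_norm f = `|f y| & forall x, `|f x| <= `|f y|.
Proof.
have [y yP] := C0_maximum f; exists y => //.
have sup_y : supremums (range (fun x => `|f x|)) `|f y|.
  by split=> [_ [x _ <-]|u]; [exact: yP|apply; exists y].
rewrite /C0_norm /supremum ifF; last first.
  by apply/negP => /eqP/seteqP[+ _] => /(_ `|f y|); apply; exists y.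
by apply: (@is_subset1_supremums _ _ (range (fun x => `|f x|))) => //; exact: xgetI sup_y.
Qed.

Lemma C0_norm_ub f x : `|f x| <= C0_norm f.
Proof. by have [y ->] := C0_norm_max f; exact. Qed.

Lemma C0_norm_le f M : (forall x, `|f x| <= M) -> C0_norm f <= M.
Proof. by have [y -> _] := C0_norm_max f; exact. Qed.

Lemma C0_normD f g : C0_norm (f + g) <= C0_norm f + C0_norm g.
Proof.
apply: C0_norm_le => x; apply: le_trans (ler_normD _ _) _.
by apply: lerD; exact: C0_norm_ub.
Qed.

Lemma C0_normZ (c : K) f : C0_norm (c *: f) = `|c| * C0_norm f.
Proof.
apply/le_anti/andP; split.
  by apply: C0_norm_le => x; rewrite normrM ler_wpM2l// C0_norm_ub.
have [y -> _] := C0_norm_max f; rewrite -normrM.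
exact: (C0_norm_ub (c *: f) y).
Qed.

Lemma C0_norm_eq0 f : C0_norm f = 0 -> f = 0.
Proof.
move=> f0; apply: C0P => x; apply/eqP; rewrite -normr_le0 -f0.
exact: C0_norm_ub.
Qed.

HB.instance Definition _ :=
  Lmodule_isNormed.Build K C0 C0_normD C0_normZ C0_norm_eq0.

End C0.

Arguments C0 K {d} W.

Section BoundedOperators.
Context (K : numFieldType) (X : normedModType K).

Definition bounded_linear : {pred X -> X} :=
  fun T => `[< linear T /\ exists M, forall x, `|T x| <= M * `|x| >].

Lemma bounded_linear_submod : submod_closed bounded_linear.
Proof.
split=> [|c S T /asboolP[Sl [M SM]] /asboolP[Tl [N TN]]]; apply/asboolP.
  split=> [a x y|]; first by rewrite [RHS]addr0 scaler0.
  by exists 0 => x; rewrite normr0 mul0r.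
split=> [a x y|].
  by rewrite !fctE Sl Tl !scalerDr !scalerA addrACA [c * a]mulrC.
exists (`|c| * M + N) => x; apply: le_trans (ler_normD _ _) _.
by rewrite mulrDl lerD// normrZ -mulrA ler_wpM2l.
Qed.

HB.instance Definition _ := GRing.isSubmodClosed.Build K (X -> X)
  bounded_linear bounded_linear_submod.

Record bounded_operator := BoundedOperator {
  bounded_operator_fun :> X -> X;
  _ : bounded_operator_fun \in bounded_linear
}.

HB.instance Definition _ := [isSub for bounded_operator_fun].
HB.instance Definition _ := [Choice of bounded_operator by <:].
HB.instance Definition _ := [SubChoice_isSubLmodule of bounded_operator by <:].

Implicit Types S T U : bounded_operator.

Lemma bounded_operator_linear T : linear T.
Proof. by have /asboolP[] := valP T. Qed.

HB.instance Definition _ T :=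
  GRing.isLinear.Build K X X *:%R T (bounded_operator_linear T).

Lemma bounded_operator_bounded T : exists M, forall x, `|T x| <= M * `|x|.
Proof. by have /asboolP[] := valP T. Qed.

Lemma bounded_operatorP S T : (forall x, S x = T x) -> S = T.
Proof. by move=> ST; apply/val_inj/funext. Qed.

Lemma id_bounded_linear : id \in bounded_linear.
Proof. by apply/asboolP; split=> //; exists 1 => x; rewrite mul1r. Qed.

Lemma comp_bounded_linear S T : S \o T \in bounded_linear.
Proof.
apply/asboolP; split=> [a x y|]; first by rewrite /= !linearP.
have [M SM] := bounded_operator_bounded S.
have [N TN] := bounded_operator_bounded T.
exists (`|M| * N) => x /=; rewrite (le_trans (SM _))// -mulrA.
have [->|Tx0] := eqVneq (T x) 0.
  rewrite normr0 mulr0 mulr_ge0// (le_trans _ (TN x))//.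
have M0 : 0 <= M.
  by have := le_trans (normr_ge0 _) (SM (T x)); rewrite pmulr_lge0// normr_gt0.
by rewrite ger0_norm// ler_wpM2l.
Qed.

Definition operator_id := BoundedOperator id_bounded_linear.
Definition operator_comp S T := BoundedOperator (comp_bounded_linear S T).

Lemma operator_compA : associative operator_comp.
Proof. by move=> S T U; exact: bounded_operatorP. Qed.
Lemma operator_comp1l : left_id operator_id operator_comp.
Proof. by move=> T; exact: bounded_operatorP. Qed.
Lemma operator_comp1r : right_id operator_id operator_comp.
Proof. by move=> T; exact: bounded_operatorP. Qed.
Lemma operator_compDl : left_distributive operator_comp +%R.
Proof. by move=> S T U; exact: bounded_operatorP. Qed.
Lemma operator_compDr : right_distributive operator_comp +%R.
Proof. by move=> S T U; apply: bounded_operatorP => x /=; rewrite linearD. Qed.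

HB.instance Definition _ := GRing.Zmodule_isPzRing.Build bounded_operator
  operator_compA operator_comp1l operator_comp1r operator_compDl operator_compDr.

End BoundedOperators.

Section OperatorAlgebra.
Context (K : numFieldType) d (W : omega1Type d).

Lemma C0_nontrivial : exists f : C0 K W, f != 0.
Proof.
have [m mP] := omega1_min W; have [b mb] := omega1_gt m.
pose g (x : W) : K := if x == m then 1 else 0.
have gC0 : g \in @continuous_vanishing_eventually K d W.
  apply/asboolP; split=> [x|]; last first.
    exists b => x bx; rewrite /g ifN//; apply: contraTneq bx => ->.
    by rewrite -ltNge.
  have [|s /= ms sP] := @omega1_well_ordered d W [set y | (m < y)%O].
    by exists b.
  apply: cvg_near_cst; have [->|xm] := eqVneq x m.
    have : nbhs m [set` `]-oo, s[%O].
      by apply: open_nbhs_nbhs; split; [exact: lray_open|rewrite /= in_itv].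
    apply: filterS => t /=; rewrite in_itv /= => ts; rewrite /g eqxx.
    case: eqP => // /eqP tm.
    have : (s <= t)%O by apply: sP; rewrite /= lt_neqAle eq_sym tm mP.
    by rewrite leNgt ts.
  have : nbhs x [set` `]m, +oo[%O].
    apply: open_nbhs_nbhs; split; first exact: rray_open.
    by rewrite /= in_itv /= andbT lt_neqAle eq_sym xm mP.
  apply: filterS => t /=; rewrite in_itv /= andbT => mt.
  by rewrite /g (negPf xm) gt_eqF.
exists (MkC0 gC0); apply/eqP => /(congr1 (fun f : C0 K W => f m)) /eqP.
by rewrite /= /g eqxx oner_eq0.
Qed.

Lemma operator_id_neq0 : (1 : bounded_operator (C0 K W)) != 0.
Proof.
have [f f0] := C0_nontrivial; apply: contra_neq f0.
by move=> /(congr1 (fun T : bounded_operator (C0 K W) => T f)).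
Qed.

HB.instance Definition _ :=
  GRing.PzSemiRing_isNonZero.Build (bounded_operator (C0 K W)) operator_id_neq0.

Lemma operator_scaleAl (c : K) (S T : bounded_operator (C0 K W)) :
  c *: (S * T) = (c *: S) * T.
Proof. exact: bounded_operatorP. Qed.

HB.instance Definition _ :=
  GRing.Lmodule_isLalgebra.Build K (bounded_operator (C0 K W)) operator_scaleAl.

Lemma operator_scaleAr (c : K) (S T : bounded_operator (C0 K W)) :
  c *: (S * T) = S * (c *: T).
Proof. by apply: bounded_operatorP => f /=; rewrite linearZ. Qed.

HB.instance Definition _ :=
  GRing.Lalgebra_isAlgebra.Build K (bounded_operator (C0 K W)) operator_scaleAr.

End OperatorAlgebra.

Definition is_character (K : numFieldType) (A : algType K) (chi : A -> K) :=
  [/\ scalar chi, forall a b, chi (a * b) = chi a * chi b & exists a, chi a != 0].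

(* The interface omega1Type is inhabited: well-order [nat -> bool] and keep the
   least initial segment that is uncountable. *)
Lemma well_order_anti (U : eqType) (le : rel U) :
  wochoice.well_order le -> antisymmetric le.
Proof.
move=> le_wo.
have le_refl x : le x x.
  have [|m [[]]] := @le_wo (mem (pred1 x)); first by exists x; rewrite inE.
  by rewrite inE => /eqP-> lem _; rewrite lem// inE.
move=> x y /andP[xy yx]; have [|m [_ mU]] := @le_wo (mem (pred2 x y)).
  by exists x; rewrite inE eqxx.
by rewrite -(mU x) ?(mU y)//; split; rewrite ?inE ?eqxx ?orbT// => t /orP[] /eqP->.
Qed.

Section WellOrderedSub.
Context (U : choiceType) (le : rel U) (le_wo : wochoice.well_order le) (P : {pred U}).

Definition well_ordered_sub (_ : wochoice.well_order le) := {x : U | x \in P}.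
Local Notation V := (well_ordered_sub le_wo).

HB.instance Definition _ := Choice.on V.

Let le_total' : total le.
Proof.
move=> x y; have [|m [[]]] := @le_wo (mem (pred2 x y)).
  by exists x; rewrite inE eqxx.
by rewrite inE => /orP[] /eqP-> lem _; rewrite lem ?orbT// inE eqxx ?orbT.
Qed.

Let le_anti' : antisymmetric le.
Proof. exact: well_order_anti. Qed.

Let le_trans' : transitive le.
Proof.
move=> y x z xy yz.
have [|m [[]]] := @le_wo (mem ([pred t | [|| t == x, t == y | t == z]])).
  by exists x; rewrite inE eqxx.
rewrite inE => /or3P[] /eqP-> lem _.
- by apply: lem; rewrite inE eqxx !orbT.
- by rewrite (@le_anti' x y)// xy lem// inE eqxx.
- by rewrite -(@le_anti' y z)// yz lem// inE eqxx orbT.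
Qed.

Definition sub_le : rel V := fun x y => le (val x) (val y).

Let sub_le_refl : reflexive sub_le.
Proof. by move=> x; have := le_total' (val x) (val x); rewrite orbb. Qed.
Let sub_le_anti : antisymmetric sub_le.
Proof. by move=> x y xy; apply/val_inj/le_anti'. Qed.
Let sub_le_trans : transitive sub_le.
Proof. by move=> y x z; exact: le_trans'. Qed.

HB.instance Definition _ :=
  Order.Le_isPOrder.Build (Order.Disp tt tt) V sub_le_refl sub_le_anti sub_le_trans.

Let sub_le_total : total (<=%O : rel V).
Proof. by move=> x y; exact: le_total'. Qed.

HB.instance Definition _ := Order.POrder_isTotal.Build _ V sub_le_total.

Lemma sub_well_ordered (A : set V) : A !=set0 -> exists2 m, A m & lbound A m.
Proof.
case=> a Aa.
have [|m [[]]] := @le_wo (mem ([pred t | `[< exists2 v, A v & val v = t >]])).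
  by exists (val a); apply/asboolP; exists a.
move=> /asboolP[v Av <-] lem _; exists v => // w Aw; apply: lem.
by apply/asboolP; exists w.
Qed.

End WellOrderedSub.

Section Initial.
Context (U : choiceType) (le : rel U) (le_wo : wochoice.well_order le) (P : {pred U}).

Local Notation V := (order_topology (@well_ordered_sub U le P le_wo)).

Context (P_uncountable : ~ countable [set x | x \in P]).
Context (P_initial :
  forall a, a \in P -> countable [set x | [&& x \in P, x != a & le x a]]).

Let V_uncountable : ~ countable [set: V].
Proof.
move=> cV; apply: P_uncountable.
have -> : [set x | x \in P] = (val : V -> U) @` setT.
  apply/seteqP; split=> [x xP|_ [x _ <-]]; last exact: valP x.
  by exists (Sub x xP).
exact: sub_countable (card_image_le _ _) cV.
Qed.

Let V_initial (a : V) : countable [set x | (x < a)%O].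
Proof.
rewrite -(eq_countable (inj_card_eq (f := (val : V -> U)) _)); last first.
  by move=> x y _ _; exact: val_inj.
apply: sub_countable (P_initial (valP a)); apply: subset_card_le => _ [x /= xa <-].
move: xa; rewrite lt_neqAle => /andP[xa lexa].
by apply/and3P; split; [exact: valP x| |].
Qed.

Lemma well_ordered_initial_omega1 : exists d, inhabited (omega1Type d).
Proof.
pose m := isOmega1.Build _ V (@sub_well_ordered U le le_wo P) V_uncountable V_initial.
pose W : omega1Type _ := HB.pack V m.
by eexists; constructor; exact: W.
Qed.

End Initial.

Lemma omega1_exists : exists d, inhabited (omega1Type d).
Proof.
pose U := (nat -> bool) : choiceType.
have U_uncountable : ~ countable [set: U].
  move=> /countable_injP[f f_inj].
  pose g n : bool := `[< exists2 u : U, f u = n & ~~ u n >].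
  have [gfg|gfg] := boolP (g (f g)).
    have /asboolP[u ufg] := gfg; have -> : u = g by apply: f_inj; rewrite ?inE.
    by rewrite gfg.
  by move: (gfg) => /asboolP; apply; exists g.
have [le le_wo] := wochoice.well_ordering_principle U.
pose seg (a : U) := [set x : U | (x != a) && le x a].
have [seg_c|/existsNP[b segb]] := pselect (forall a, countable (seg a)).
  apply: (@well_ordered_initial_omega1 U le le_wo predT) => [|a _].
    by rewrite (_ : [set x | _] = setT)//; apply/seteqP.
  exact: seg_c.
have [|m [[/asboolP segm mP] _]] := @le_wo (mem ([pred a | `[< ~ countable (seg a) >]])).
  by exists b; apply/asboolP.
apply: (@well_ordered_initial_omega1 U le le_wo [pred x | (x != m) && le x m]) => [//|a].
rewrite inE => /andP[am lam].
suff : countable (seg a).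
  by apply: sub_countable; apply: subset_card_le => x /= /and3P[_ xa xla]; apply/andP.
apply: contrapT => sega; have lma : le m a by apply: mP; apply/asboolP.
by move/eqP: am; apply; apply: (well_order_anti le_wo); rewrite lam.
Qed.

(* Main.v *)
Require Import Defs.
From mathcomp Require Import all_boot all_order all_algebra.
From mathcomp Require Import complex.
From mathcomp Require Import all_classical all_reals.
From mathcomp Require Import topology normedtype.

Set Implicit Arguments.
Unset Strict Implicit.
Unset Printing Implicit Defensive.

Import Order.TTheory GRing.Theory Num.Theory.
Import numFieldNormedType.Exports.

Local Open Scope classical_set_scope.
Local Open Scope ring_scope.

(* The indicators of the clopen intervals [0, a] lie in C_0[0, omega_1). For fixed c,
   transfinite induction on c shows that T f vanishes beyond a bound common to all f
   supported in [0, c]; for fixed b, boundedness of f |-> T f b gives a bound such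
   that T f b = 0 whenever f is supported beyond it. Hence, at every limit ordinal a closed
   under both bounds, T f a depends only on the values of f in arbitrarily small
   intervals ]y, a], so that T f a = lam(a) f(a) with lam(a) = (T 1_[0,a])(a). On such
   points below a, lam agrees with the continuous function T 1_[0,a], and this forces
   lam to be constant on a club. *)

(** * Closed unbounded sets and closure points of functions *)

Section Omega1Club.
Context d (W : omega1Type d).
Implicit Types (x y a b : W) (h : W -> W) (D : set W).

(** Otherwise the countable closed initial segments ending at points of [A] would cover the
    uncountable [W]. *)
Lemma countable_bounded (A : set W) :
  countable A -> exists b, forall x, A x -> (x < b)%O.
Proof.
move=> cA; apply: contrapT => /forallNP unbA.
apply: (@omega1_uncountable d W).
have -> : [set: W] = \bigcup_(x in A) ([set y | (y < x)%O] `|` [set x]).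
  apply/seteqP; split => // y _; have /existsNP[x /not_implyP[Ax xy]] := unbA y.
  exists x => //; have : (y <= x)%O by rewrite leNgt; exact/negP.
  by rewrite le_eqVlt => /orP[/eqP->|]; [right|left].
apply: bigcup_countable => // x _; rewrite -bigcup2E.
apply: bigcup_countable; first exact: countableP.
move=> [|[|n]] _ /=; [exact: omega1_countable_initial| |exact: countable0].
exact: finite_set_countable.
Qed.

Lemma sequence_bounded (u : nat -> W) : exists b, forall n, (u n < b)%O.
Proof.
have [|b bP] := @countable_bounded (range u).
  exact: sub_countable (card_image_le _ _) (countableP _).
by exists b => n; apply: bP; exists n.
Qed.

Lemma initial_image_bounded h a : exists b, forall x, (x < a)%O -> (h x < b)%O.
Proof.
have [|b bP] := @countable_bounded (h @` [set x | (x < a)%O]).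
  exact: sub_countable (card_image_le _ _) (omega1_countable_initial a).
by exists b => x xa; apply: bP; exists x.
Qed.

(** The set is the open ray below the successor [s] of [x]. *)
Lemma nbhs_le x : nbhs x [set t | (t <= x)%O].
Proof.
have [b xb] := omega1_gt x.
have [|s /= xs sP] := @omega1_well_ordered d W [set y | (x < y)%O]; first by exists b.
have : nbhs x [set` `]-oo, s[%O].
  by apply: open_nbhs_nbhs; split; [exact: lray_open|rewrite /= in_itv].
apply: filterS => t /=; rewrite in_itv /= => ts; rewrite leNgt; apply/negP => xt.
by have := sP _ xt; rewrite leNgt ts.
Qed.

Lemma nbhs_gt x y : (y < x)%O -> nbhs x [set t | (y < t)%O].
Proof.
move=> yx; have : nbhs x [set` `]y, +oo[%O].
  by apply: open_nbhs_nbhs; split; [exact: rray_open|rewrite /= in_itv /= andbT].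
by apply: filterS => t /=; rewrite in_itv /= andbT.
Qed.

(** The first condition excludes the minimum of [W], where the second holds vacuously. *)
Definition closure_points h : set W :=
  [set a | (exists b, (b < a)%O) /\ forall b, (b < a)%O -> (h b < a)%O].

(** Iterating a function [g] that dominates [h] on initial segments gives an increasing sequence
    from [x]; its supremum is closed under [h]. *)
Lemma closure_points_unbounded h x : exists2 a, closure_points h a & (x < a)%O.
Proof.
have /choice[g gP] : forall c, exists e, (c < e)%O /\
    forall b, (b < c)%O -> (h b < e)%O.
  move=> c; have [e eP] := initial_image_bounded h c; have [s cs] := omega1_gt c.
  exists (Order.max e s); rewrite lt_max cs orbT; split=> // b /eP.
  by rewrite lt_max => ->.
pose u n := iter n g x; have [b0 b0P] := sequence_bounded u.
have [|a aP amin] := @omega1_well_ordered d W [set a | forall n, (u n < a)%O].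
  by exists b0.
exists a; last exact: (aP 0).
split=> [|b ba]; first by exists x; exact: (aP 0).
have /existsNP[n /negP] : ~ forall n, (u n < b)%O.
  by move=> /amin; rewrite leNgt ba.
(* Two steps are needed: [b <= u n < u n.+1] is strict, so [g] gives [h b < u n.+2]. *)
rewrite -leNgt => bn; apply: lt_trans (aP n.+2).
by have [_] := gP (u n.+1); apply; apply: le_lt_trans bn _; have [] := gP (u n).
Qed.

Lemma closure_points_club h : club (closure_points h).
Proof.
split=> [a ca|[b bP]]; last first.
  have [a /bP ab ba] := closure_points_unbounded h b.
  by rewrite leNgt ba in ab.
split=> [|b ba].
  have [c [[[b bc] _] /= ca']] := ca _ (nbhs_le a).
  by exists b; exact: lt_le_trans ca'.
have [c [[_ hc] /= [ca' bc]]] := ca _ (filterI (nbhs_le a) (nbhs_gt ba)).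
exact: lt_le_trans (hc _ bc) ca'.
Qed.

Lemma closure_points_max h1 h2 a :
  closure_points (fun x => Order.max (h1 x) (h2 x)) a ->
  closure_points h1 a /\ closure_points h2 a.
Proof.
move=> [nz ha]; split; split=> // b /ha; rewrite gt_max.
  by case/andP.
by case/andP.
Qed.

(** Let [h b] be a point of [D] beyond [b]: a point closed under [h] is a limit of points of [D]. *)
Lemma club_closure_points D :
  club D -> exists h, closure_points h `<=` D.
Proof.
move=> [Dcl Dub].
have /choice[h hP] : forall b, exists c, D c /\ (b < c)%O.
  move=> b; apply: contrapT => /forallNP nc; apply: Dub; exists b => c Dc.
  by rewrite leNgt; apply/negP => bc; apply: (nc c).
exists h => a [[z za] ha]; apply: Dcl => B aB.
have [y ya yB] := omega1_nbhs_left za aB; have [Dy yh] := hP y.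
by exists (h y); split=> //; apply: yB => //; exact/ltW/ha.
Qed.

Lemma clubI D1 D2 : club D1 -> club D2 -> club (D1 `&` D2).
Proof.
move=> D1c D2c; split; first by apply: closedI; [case: D1c|case: D2c].
have [h1 h1D] := club_closure_points D1c; have [h2 h2D] := club_closure_points D2c.
move=> [b bP].
have [a /closure_points_max[/h1D D1a /h2D D2a] ba] :=
  closure_points_unbounded (fun x => Order.max (h1 x) (h2 x)) b.
have ab := bP a (conj D1a D2a).
by rewrite leNgt ba in ab.
Qed.

Lemma club_setT : club [set: W].
Proof.
split; first exact: closedT.
by move=> [b bP]; have [c bc] := omega1_gt b; have := bP c I; rewrite leNgt bc.
Qed.

Lemma club_nonempty D : club D -> D !=set0.
Proof.
move=> [_ Dub]; apply: contrapT => D0; apply: Dub.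
have [m _] := omega1_min W; exists m => x Dx.
by case: D0; exists x.
Qed.

End Omega1Club.

(** * Phases and Archimedean estimates for scalars *)

Section NumField.
Context (K : numFieldType).

(** For non-zero [u] and [v], the phase of [u] over that of [v] turns [c * v] into a positive
    multiple of [u]. *)
Lemma align_phase (u v : K) :
  exists2 c : K, `|c| = 1 & `|u + c * v| = `|u| + `|v|.
Proof.
have [->|u0] := eqVneq u 0; first by exists 1; rewrite ?normr1// normr0 mul1r !add0r.
have [->|v0] := eqVneq v 0; first by exists 1; rewrite ?normr1// normr0 mulr0 !addr0.
exists (u / `|u| * (`|v| / v)).
  by rewrite !normrM !normfV !normr_id divff ?normr_eq0// divff ?normr_eq0// mulr1.
rewrite -mulrA divfK// -{1}[u](@divfK _ `|u|) ?normr_eq0// -mulrDr normrM.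
rewrite normrM normfV normr_id divff ?normr_eq0// mul1r ger0_norm//.
exact: addr_ge0.
Qed.

Lemma norm_le_eps_eq0 (x M : K) : 0 <= M ->
  (forall e, 0 < e -> `|x| <= M * e) -> x = 0.
Proof.
move=> M0 xM; apply/eqP; apply: contraT => x0.
have M1 : 0 < M + 1 by rewrite ltr_wpDl.
have := xM (`|x| / (M + 1)); rewrite divr_gt0 ?normr_gt0// => /(_ isT).
rewrite mulrCA ler_pMr ?normr_gt0// ler_pdivlMr// mul1r -subr_ge0.
by rewrite opprD addrA subrr sub0r oppr_ge0 ler10.
Qed.

Hypothesis hK : real_or_complex K.

(** A complex modulus is the image of a real number, so the Archimedean property of the reals covers
    both cases. *)
Lemma real_or_complex_archi (x : K) : exists n, `|x| < n%:R.
Proof.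
case: hK x => R x.
  exists (Num.truncn `|x|).+1; exact: truncnS_gt.
rewrite normc_def; set r := Num.sqrt _; exists (Num.truncn r).+1.
rewrite -(rmorph_nat (real_complex R)) ltcR; exact: truncnS_gt.
Qed.

Lemma norm_le_inv_nat_eq0 (x M : K) :
  (forall n, `|x| <= n.+1%:R^-1 * M) -> x = 0.
Proof.
move=> xM; apply/eqP; apply: contraT => x0.
have [n] := real_or_complex_archi (M / x).
rewrite normrM normfV ltr_pdivrMr ?normr_gt0// => Mn.
have := xM n; rewrite ler_pdivlMl ?ltr0Sn// => nM.
have M0 : 0 <= M by apply: le_trans nM; rewrite mulr_ge0.
rewrite ger0_norm// in Mn; have := le_lt_trans nM Mn.
by rewrite ltr_pM2r ?normr_gt0// ltr_nat ltnNge leqnSn.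
Qed.

End NumField.

(** * Truncation to the clopen intervals [0, a] *)

Section Cut.
Context (K : numFieldType) d (W : omega1Type d).
Implicit Types (f g : C0 K W) (a b x y : W).

Definition cut_fun (g : W -> K) a x : K := if (x <= a)%O then g x else 0.

Lemma cut_fun_C0 (g : W -> K) a :
  continuous g -> cut_fun g a \in @continuous_vanishing_eventually K d W.
Proof.
move=> gc; apply/asboolP; split=> [x|]; last first.
  by have [b ab] := omega1_gt a; exists b => x bx; rewrite /cut_fun leNgt (lt_le_trans ab).
have [xa|ax] := leP x a.
  rewrite /continuous_at {2}/cut_fun xa.
  apply: cvg_trans (gc x); apply: near_eq_cvg.
  apply: filterS (nbhs_le x) => t /= tx.
  by rewrite /cut_fun (le_trans tx xa).
apply: cvg_near_cst; apply: filterS (nbhs_gt ax) => t /= ta.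
by rewrite /cut_fun !leNgt ta ax.
Qed.

Definition cut f a : C0 K W := MkC0 (cut_fun_C0 a (@C0_continuous K d W f)).

(** The indicator of [0, a]. It is not a case of [cut], as the constant 1 does not vanish
    eventually. *)
Definition cut1 a : C0 K W := MkC0 (cut_fun_C0 a (fun x => cvg_cst (1 : K))).

Lemma cutE f a x : cut f a x = if (x <= a)%O then f x else 0.
Proof. by []. Qed.

Lemma cut1E a x : cut1 a x = if (x <= a)%O then 1 else 0.
Proof. by []. Qed.

Lemma C0_subE f g x : (f - g) x = f x - g x.
Proof. by []. Qed.

End Cut.

(** * Diagonal form of an operator on a club *)

Section Operator.
Context (K : numFieldType) d (W : omega1Type d).
Context (T : bounded_operator (C0 K W)).
Implicit Types (f g : C0 K W) (a b c x y : W).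

Lemma operator_pointwise_bound :
  exists2 M : K, 0 <= M & forall f a, `|T f a| <= M * `|f|.
Proof.
have [M TM] := bounded_operator_bounded T; exists `|M| => // f a.
apply: le_trans (C0_norm_ub (T f) a) _; apply: le_trans (TM f) _.
have [->|f0] := eqVneq f 0; first by rewrite normr0 !mulr0.
have M0 : 0 <= M.
  by have := le_trans (normr_ge0 _) (TM f); rewrite pmulr_lge0// normr_gt0.
by rewrite ger0_norm.
Qed.

(** Subtracting [f c *: cut1 K c] leaves a function [h] vanishing from [c] on. By continuity at [c]
    it is a norm limit of truncations [cut h y] with [y < c], which [T] sends to functions vanishing
    at [a]. *)
Lemma operator_supported_initial a c :
  (forall b f, (b < c)%O -> (forall x, (b < x)%O -> f x = 0) -> T f a = 0) ->
  forall f, (forall x, (c < x)%O -> f x = 0) -> T f a = f c * T (cut1 K c) a.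
Proof.
move=> Tc f fc; have [M M0 TM] := operator_pointwise_bound.
pose h := f - f c *: cut1 K c.
have hE x : h x = f x - f c * cut1 K c x by [].
suff Th : T h a = 0.
  move: Th; rewrite /h linearB linearZ C0_subE => /eqP; rewrite subr_eq0.
  by move=> /eqP ->.
have hx x : (c < x)%O -> h x = 0.
  by move=> cx; rewrite hE cut1E leNgt cx mulr0 subr0 fc.
have hc : h c = 0 by rewrite hE cut1E lexx mulr1 subrr.
clearbody h; have [[z zc]|/forallNP cmin] := pselect (exists z, (z < c)%O); last first.
  (* Here [c] is the minimum of [W], and [h] vanishes everywhere. *)
  suff -> : h = 0 by rewrite linear0.
  apply: C0P => x; have [/hx//|] := ltP c x; rewrite le_eqVlt.
  by case/orP=> [/eqP->//|xc]; case: (cmin x).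
apply: (norm_le_eps_eq0 M0) => e e0.
have /cvgrPdist_lt /(_ _ e0) he := @C0_continuous K d W h c.
have [y yc yP] := omega1_nbhs_left zc he.
have -> : T h a = T (h - cut h y) a.
  rewrite linearB C0_subE (Tc y (cut h y))// ?subr0// => x yx.
  by rewrite cutE leNgt yx.
apply: le_trans (TM _ _) _; apply: ler_wpM2l => //; apply: C0_norm_le => x.
rewrite C0_subE cutE; have [xy|yx] := leP x y; first by rewrite subrr normr0 ltW.
rewrite subr0; have [xc|/hx->] := leP x c; last by rewrite normr0 ltW.
by have := yP x yx xc; rewrite /= hc sub0r normrN => /ltW.
Qed.

Lemma operator_initial_vanishing c :
  exists b, forall f, (forall x, (c < x)%O -> f x = 0) ->
    forall a, (b <= a)%O -> T f a = 0.
Proof.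
elim/omega1_ind: c => c IH.
have /choice[h hP] : forall e, exists b, (e < c)%O -> forall f,
    (forall x, (e < x)%O -> f x = 0) -> forall a, (b <= a)%O -> T f a = 0.
  move=> e; have [/IH[b bP]|_] := boolP (e < c)%O; first by exists b.
  by exists e.
(* The countably many [e < c] have a common bound [b1]; [b2] takes care of the remaining multiple of
   [cut1 K c]. *)
have [b1 b1P] := initial_image_bounded h c.
have [b2 b2P] := C0_vanishing (T (cut1 K c)).
exists (Order.max b1 b2) => f fc a; rewrite ge_max => /andP[b1a b2a].
rewrite (operator_supported_initial _ fc) ?b2P ?mulr0// => e g ec ge.
by apply: (hP e) => //; apply: le_trans b1a; exact/ltW/b1P.
Qed.

Hypothesis hK : real_or_complex K.

(* Otherwise one sums [n] disjointly supported functions with aligned phases: the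
   sum keeps norm at most 1 but has image at least [n * e] at [a]. *)
Lemma operator_tail_small a (e : K) : 0 < e ->
  exists b, forall f, (forall x, (x <= b)%O -> f x = 0) -> `|T f a| <= e * `|f|.
Proof.
move=> e0; apply: contrapT => /forallNP ntail.
have [M M0 TM] := operator_pointwise_bound.
have hump n : exists2 f, `|f| <= 1 & n%:R * e <= `|T f a|.
  elim: n => [|n [f f1 fn]]; first by exists 0; rewrite ?normr0 ?mul0r.
  have [b fb] := C0_vanishing f.
  have /existsNP[g /not_implyP[gb /negP]] := ntail b.
  (* The order on [K] may be partial, so negating the inequality requires both sides to be real. *)
  rewrite -real_ltNge ?normr_real//; last by rewrite realM ?normr_real ?gtr0_real.
  move=> ge.
  have g0 : 0 < `|g|.
    rewrite normr_gt0; apply: contraTneq ge => ->.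
    by rewrite linear0 normr0 mulr0 normr0 ltxx.
  have [u u1 uE] := align_phase (T f a) (`|g|^-1 * T g a).
  exists (f + (u / `|g|) *: g).
    apply: C0_norm_le => x.
    have -> : (f + (u / `|g|) *: g) x = f x + u / `|g| * g x by [].
    have [xb|/ltW bx] := leP x b.
      by rewrite gb// mulr0 addr0; exact: le_trans (C0_norm_ub f x) f1.
    rewrite fb// add0r !normrM u1 mul1r normfV normr_id ler_pdivrMl// mulr1.
    exact: C0_norm_ub.
  rewrite linearD linearZ.
  have -> : (T f + (u / `|g|) *: T g) a = T f a + u * (`|g|^-1 * T g a).
    by rewrite mulrA.
  rewrite uE -natr1 mulrDl mul1r lerD// normrM normfV normr_id.
  by rewrite ler_pdivlMl// mulrC ltW.
have [n] := real_or_complex_archi hK (M / e).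
rewrite ger0_norm ?divr_ge0 ?(ltW e0)// ltr_pdivrMr// => Mn.
have [f f1 fn] := hump n; have := lt_le_trans Mn (le_trans fn (TM f a)).
by move/lt_le_trans => /(_ M); rewrite ltxx ler_piMr// => /(_ isT).
Qed.

(** The bounds for the tolerances 1/(n+1) form a sequence, hence have a common upper bound. *)
Lemma operator_tail_vanishing a :
  exists b, forall f, (forall x, (x <= b)%O -> f x = 0) -> T f a = 0.
Proof.
have /choice[u uP] : forall n : nat, exists b, forall f,
    (forall x, (x <= b)%O -> f x = 0) -> `|T f a| <= n.+1%:R^-1 * `|f|.
  by move=> n; apply: operator_tail_small; rewrite invr_gt0 ltr0Sn.
have [b bP] := sequence_bounded u; exists b => f fb.
apply: (@norm_le_inv_nat_eq0 K hK _ `|f|) => n; apply: uP => x xu.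
by apply: fb; apply: le_trans xu _; exact/ltW/bP.
Qed.

Lemma operator_diagonal : exists h, [/\ forall b, (b < h b)%O &
  forall a, closure_points h a -> forall f, T f a = T (cut1 K a) a * f a].
Proof.
have /choice[s sP] : forall b : W, exists c, (b < c)%O by move=> b; exact: omega1_gt.
have /choice[h1 h1P] := operator_initial_vanishing.
have /choice[h2 h2P] := operator_tail_vanishing.
pose h b := Order.max (s b) (Order.max (h1 b) (h2 b)).
have hs b : (s b <= h b)%O by rewrite le_max lexx.
have hh1 b : (h1 b <= h b)%O by rewrite !le_max lexx orbT.
have hh2 b : (h2 b <= h b)%O by rewrite !le_max lexx !orbT.
exists h; split=> [b|a [[z za] ha] f]; first exact: lt_le_trans (sP b) (hs b).
(* Arbitrarily close below [a] there are points [s y] whose tail bound is below [a]; [T g] vanishes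
   there, hence at [a] by continuity. The shift to [s y] gives a point strictly above [y]. *)
have below g : (forall x, (x <= a)%O -> g x = 0) -> T g a = 0.
  move=> ga; apply: (@norm_le_eps_eq0 K _ 1) => // e e0; rewrite mul1r.
  have /cvgrPdist_lt /(_ _ e0) Te := @C0_continuous K d W (T g) a.
  have [y ya yP] := omega1_nbhs_left za Te.
  have ya' : (s y < a)%O := le_lt_trans (hs y) (ha y ya).
  have := yP (s y) (sP y) (ltW ya') => /=.
  rewrite (h2P (s y)) ?subr0 => [/ltW//|x xs].
  by apply: ga; apply: le_trans xs _; exact/ltW/(le_lt_trans (hh2 _))/ha.
have -> : T f a = T (cut f a) a.
  apply/eqP; rewrite -subr_eq0 -C0_subE -linearB below// => x xa.
  by rewrite C0_subE cutE xa subrr.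
rewrite (@operator_supported_initial a a) => [|b g ba gb|x ax].
- by rewrite cutE lexx mulrC.
- by apply: (h1P b) => //; apply: le_trans (hh1 b) _; exact/ltW/ha.
- by rewrite cutE leNgt ax.
Qed.

Lemma operator_scalar_on_club : exists c : K, exists2 D : set W, club D &
  forall f a, D a -> T f a = c * f a.
Proof.
have [h [hlt hP]] := operator_diagonal; pose lam a := T (cut1 K a) a.
have lam_small (e : K) : 0 < e -> exists b, forall x y,
    closure_points h x -> closure_points h y -> (b <= x)%O -> (b <= y)%O ->
    `|lam x - lam y| <= e.
  (* If lam oscillated by more than [e] cofinally, T 1_[0,a] would be discontinuous
     at any limit point [a] closed under the choice of witnesses. *)
  move=> e0; apply: contrapT => /forallNP nb.
  have /choice[p pP] : forall b, exists p : W * W,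
      [/\ closure_points h p.1, closure_points h p.2, (b <= p.1)%O, (b <= p.2)%O &
        ~ (`|lam p.1 - lam p.2| <= e)].
    move=> b; have /existsNP[x /existsNP[y]] := nb b.
    by do 4![move=> /not_implyP[?]] => ?; exists (x, y).
  pose h' b := Order.max (h b) (Order.max (p b).1 (p b).2).
  have [m _] := omega1_min W.
  have [a /closure_points_max[ha /closure_points_max[[_ hp1] [_ hp2]]] _] :=
    closure_points_unbounded h' m.
  have [[z za] ha'] := ha.
  have e20 : 0 < e / 2 by rewrite divr_gt0.
  have /cvgrPdist_lt /(_ _ e20) Te := @C0_continuous K d W (T (cut1 K a)) a.
  have [y ya yP] := omega1_nbhs_left za Te.
  (* Witnesses beyond [h y] lie strictly above [y], where [T (cut1 K a)] is within [e / 2] of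
     [lam a]. *)
  have hya := ha' y ya; have [c1 c2 l1 l2 []] := pP (h y).
  have near_lam x : closure_points h x -> (h y <= x)%O -> (x < a)%O ->
      `|lam a - lam x| < e / 2.
    move=> hx yx xa; have := yP x (lt_le_trans (hlt y) yx) (ltW xa).
    by rewrite /= (hP x)// cut1E (ltW xa) mulr1.
  rewrite -(subrK (lam a) (lam _)) -addrA (splitr e) ltW//.
  apply: le_lt_trans (ler_normD _ _) _.
  by apply: ltrD; [rewrite distrC|]; apply: near_lam => //; [exact: hp1|exact: hp2].
have /choice[u uP] : forall n : nat, exists b, forall x y,
    closure_points h x -> closure_points h y -> (b <= x)%O -> (b <= y)%O ->
    `|lam x - lam y| <= n.+1%:R^-1.
  by move=> n; apply: lam_small; rewrite invr_gt0 ltr0Sn.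
(* Beyond [b] all the oscillation estimates hold at once, so [lam] is constant on the closure points
   there. *)
have [b bP] := sequence_bounded u.
have [a0 ha0 ba0] := closure_points_unbounded h b.
(* The constant [b] in the maximum forces [b < a], since some [z] lies below [a]. *)
exists (lam a0), (closure_points (fun x => Order.max (h x) b)).
  exact: closure_points_club.
move=> f a /closure_points_max[ha [[z za] /(_ _ za) ba]]; rewrite hP//.
congr (_ * _); apply/eqP; rewrite -subr_eq0; apply/eqP.
apply: (@norm_le_inv_nat_eq0 K hK _ 1) => n; rewrite mulr1.
by apply: uP => //; apply: ltW; [apply: lt_trans ba|apply: lt_trans ba0]; exact: bP.
Qed.

(** Two clubs meet, and at a common point [a] the function [cut1 K a] takes the value 1. *)
Lemma operator_scalar_unique (c1 c2 : K) (D1 D2 : set W) : club D1 -> club D2 ->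
  (forall f a, D1 a -> T f a = c1 * f a) -> (forall f a, D2 a -> T f a = c2 * f a) ->
  c1 = c2.
Proof.
move=> D1c D2c T1 T2; have [a [D1a D2a]] := club_nonempty (clubI D1c D2c).
have := T1 (cut1 K a) a D1a.
by rewrite T2// cut1E lexx !mulr1.
Qed.

End Operator.

(** * The character obtained from the scalars *)

Theorem theorem1p3 (K : numFieldType) (hK : real_or_complex K)
    (d : Order.disp_t) (W : omega1Type d) :
  exists phi : bounded_operator (C0 K W) -> K,
    (forall T : bounded_operator (C0 K W),
       unique (fun c : K => exists2 D : set W, club D &
                 forall (f : C0 K W) (a : W), D a -> T f a = c * f a)
              (phi T)) /\
    is_character phi.
Proof.
have /choice[phi phiP] := fun T => @operator_scalar_on_club K d W T hK.
(* Each algebraic identity for [phi] then needs only one club where the pointwise formula holds; for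
   two operators it is the intersection of their clubs. *)
have phi_eq (T : bounded_operator (C0 K W)) c (D : set W) : club D ->
    (forall (f : C0 K W) a, D a -> T f a = c * f a) -> phi T = c.
  move=> Dc DT; have [E Ec ET] := phiP T.
  exact: operator_scalar_unique Ec Dc ET DT.
exists phi; split=> [T|]; first by split=> // c [D Dc DT]; exact: phi_eq Dc DT.
split=> [c S T|S T|].
- have [D Dc DS] := phiP S; have [E Ec ET] := phiP T.
  apply: (phi_eq _ _ _ (clubI Dc Ec)) => f a [Da Ea].
  have -> : (c *: S + T) f a = c * S f a + T f a by [].
  by rewrite DS// ET// mulrDl mulrA.
- have [D Dc DS] := phiP S; have [E Ec ET] := phiP T.
  apply: (phi_eq _ _ _ (clubI Dc Ec)) => f a [Da Ea].
  have -> : (S * T) f a = S (T f) a by [].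
  by rewrite DS// ET// mulrA.
- exists 1; rewrite (phi_eq 1 1 _ (@club_setT d W)) ?oner_eq0// => f a _.
  by rewrite mul1r.
Qed.
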